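(* Let $\boldsymbol{W}\in\mathbb{C}^{N_t\times N_t}$ be a Hermitian positive semi-definite matrix, and let $$\mathrm{PCRB}_\theta(\boldsymbol W)=\frac{1}{\sum_{k=1}^{K}\frac{p_k}{\sigma_k^2}-\rho+\frac{2|\alpha|^2L}{\sigma_s^2}\left(\mathrm{tr}((\boldsymbol{A}_1+\boldsymbol{A}_2)\boldsymbol{W})-\frac{|\mathrm{tr}(\boldsymbol{A}_3\boldsymbol{W})|^2}{\mathrm{tr}(\boldsymbol{A}_4\boldsymbol{W})}\right)}.$$ Then $$\mathrm{PCRB}_\theta(\boldsymbol W)\le \mathrm{PCRB}_\theta^U(\boldsymbol W):=\frac{1}{\sum_{k=1}^{K}\frac{p_k}{\sigma_k^2}-\rho+\frac{2|\alpha|^2L}{\sigma_s^2}\,\mathrm{tr}(\boldsymbol{A}_1\boldsymbol{W})}.$$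
   Context: Fix integers $N_t,N_r,L,K\ge 1$, real numbers $d,\lambda,r,\sigma_s>0$ and $h_B$ with $0\le h_B<r$, set $\cos\phi=\sqrt{r^2-h_B^2}/r>0$, and let $\alpha\in\mathbb{C}\setminus\{0\}$. For $\theta\in\mathbb{R}$ define $\boldsymbol a(\theta)\in\mathbb{C}^{N_t}$ and $\boldsymbol b(\theta)\in\mathbb{C}^{N_r}$ by $a_n(\theta)=e^{-j\pi d(N_t-2n+1)\cos\phi\sin\theta/\lambda}$ ($n=1,\dots,N_t$) and $b_m(\theta)=e^{-j\pi d(N_r-2m+1)\cos\phi\sin\theta/\lambda}$ ($m=1,\dots,N_r$), where $j$ is the imaginary unit; $\dot{\boldsymbol a}(\theta),\dot{\boldsymbol b}(\theta)$ are the entrywise derivatives with respect to $\theta$. The superscript $H$ is conjugate transpose. The prior density of $\theta$ is the Gaussian mixture $p_\Theta(\theta)=\sum_{k=1}^K p_k f_k(\theta)$, $f_k(\theta)=\frac{1}{\sqrt{2\pi}\sigma_k}e^{-(\theta-\theta_k)^2/(2\sigma_k^2)}$, with $p_k\in[0,1]$, $\sum_k p_k=1$, $\sigma_k>0$, $\theta_k\in[-\pi/2,\pi/2)$. All integrals are over $\mathbb{R}$. Define $$\rho=\int\frac{\sum_{k_1=1}^K\sum_{k_2=1}^K p_{k_1}p_{k_2}f_{k_1}(\theta)f_{k_2}(\theta)\left(\frac{\theta-\theta_{k_1}}{\sigma_{k_1}^2}-\frac{\theta-\theta_{k_2}}{\sigma_{k_2}^2}\right)^2}{2\sum_{k=1}^K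 p_kf_k(\theta)}\,d\theta ,$$ so that $\sum_k p_k/\sigma_k^2-\rho=\int\left(\frac{d}{d\theta}\ln p_\Theta(\theta)\right)^2p_\Theta(\theta)\,d\theta$ is the Fisher information of the prior. Define the $N_t\times N_t$ matrices $\boldsymbol A_1=\int\|\dot{\boldsymbol b}(\theta)\|^2\boldsymbol a(\theta)\boldsymbol a^H(\theta)p_\Theta(\theta)d\theta$, $\boldsymbol A_2=N_r\int\dot{\boldsymbol a}(\theta)\dot{\boldsymbol a}^H(\theta)p_\Theta(\theta)d\theta$, $\boldsymbol A_3=N_r\int\dot{\boldsymbol a}(\theta)\boldsymbol a^H(\theta)p_\Theta(\theta)d\theta$, $\boldsymbol A_4=N_r\int\boldsymbol a(\theta)\boldsymbol a^H(\theta)p_\Theta(\theta)d\theta$. Convention: the fraction $|\mathrm{tr}(\boldsymbol A_3\boldsymbol W)|^2/\mathrm{tr}(\boldsymbol A_4\boldsymbol W)$ is taken to be $0$ if $\mathrm{tr}(\boldsymbol A_4\boldsymbol W)=0$ (which occurs for $\boldsymbol W=\boldsymbol 0$). $\mathrm{PCRB}_\theta$ is the posterior Cramér-Rao bound for estimating $\theta$ (jointly with the unknown deterministic $\alpha$) from the echo $\boldsymbol Y=\alpha\boldsymbol b(\theta)\boldsymbol a^H(\theta)\boldsymbol X+\text{noise}$ with transmit covariance $\boldsymbol W$. *)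

(* Defs.v *)
From mathcomp Require Import all_boot all_order all_algebra spectral.
From mathcomp Require Import all_classical all_reals all_analysis.
From mathcomp Require Export complex.

Set Implicit Arguments.
Unset Strict Implicit.
Unset Printing Implicit Defensive.
Import Order.TTheory GRing.Theory Num.Theory.
Import numFieldNormedType.Exports.
Local Open Scope classical_set_scope.
Local Open Scope ring_scope.
Local Open Scope complex_scope.
Local Open Scope sesquilinear_scope.

Definition expi (R : realType) (x : R) : R[i] := cos x +i* sin x.

(* The topology that the library puts on R[i] makes it a normed module over
   itself only, so derivatives and integrals of functions from R to R[i] are
   taken on the real and imaginary parts. *)
Definition cderive (R : realType) (f : R -> R[i]) (t : R) : R[i] :=
  (derive1 (fun u => complex.Re (f u)) t : R)
  +i* (derive1 (fun u => complex.Im (f u)) t : R).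

Definition cintegral (R : realType) (f : R -> R[i]) : R[i] :=
  (\int[lebesgue_measure]_t complex.Re (f t))
  +i* (\int[lebesgue_measure]_t complex.Im (f t)).

Definition mxderive (R : realType) m n (F : R -> 'M[R[i]]_(m, n)) (t : R) :
    'M[R[i]]_(m, n) :=
  \matrix_(i, j) cderive (fun u => F u i j) t.

Definition mxintegral (R : realType) m n (F : R -> 'M[R[i]]_(m, n)) :
    'M[R[i]]_(m, n) :=
  \matrix_(i, j) cintegral (fun t => F t i j).

(* Squared Euclidean norm; the library's norm on matrices is the sup norm. *)
Definition sqnorm2 (R : realType) n (v : 'cV[R[i]]_n) : R[i] :=
  \sum_i `|v i 0| ^+ 2.

Definition psdmx (R : realType) n (W : 'M[R[i]]_n) : Prop :=
  W \is hermsymmx /\ forall x : 'cV[R[i]]_n, 0 <= (x ^t* *m W *m x) 0 0.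

Definition cos_elevation (R : realType) (r hB : R) : R :=
  Num.sqrt (r ^+ 2 - hB ^+ 2) / r.

(* Array response of N antennas; the ordinal n stands for antenna n + 1. *)
Definition steering (R : realType) (N : nat) (d lam cosphi : R) (t : R) :
    'cV[R[i]]_N :=
  \col_(n < N) expi (- (pi * d * (N%:R - 2 * n.+1%:R + 1) * cosphi * sin t
                        / lam)).

Section Prior.
Variables (R : realType) (K : nat) (p mean sigma : 'I_K -> R).

Let f (k : 'I_K) : R -> R := normal_pdf (mean k) (sigma k).

Definition gauss_mixture (t : R) : R := \sum_k p k * f k t.

Definition prior_rho : R :=
  \int[lebesgue_measure]_t
    ((\sum_k1 \sum_k2 p k1 * p k2 * f k1 t * f k2 t
        * ((t - mean k1) / sigma k1 ^+ 2 - (t - mean k2) / sigma k2 ^+ 2) ^+ 2)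
     / (2 * \sum_k p k * f k t)).

Definition prior_fisher : R := (\sum_k p k / sigma k ^+ 2) - prior_rho.

End Prior.

Section Echo.
Variables (R : realType) (Nt Nr : nat).
Variables (a : R -> 'cV[R[i]]_Nt) (b : R -> 'cV[R[i]]_Nr) (pTheta : R -> R).

Definition matA1 : 'M[R[i]]_Nt :=
  mxintegral (fun t =>
    (sqnorm2 (mxderive b t) * (pTheta t)%:C) *: (a t *m (a t) ^t* )).

Definition matA2 : 'M[R[i]]_Nt :=
  Nr%:R *: mxintegral (fun t =>
    (pTheta t)%:C *: (mxderive a t *m (mxderive a t) ^t* )).

Definition matA3 : 'M[R[i]]_Nt :=
  Nr%:R *: mxintegral (fun t =>
    (pTheta t)%:C *: (mxderive a t *m (a t) ^t* )).

Definition matA4 : 'M[R[i]]_Nt :=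
  Nr%:R *: mxintegral (fun t =>
    (pTheta t)%:C *: (a t *m (a t) ^t* )).

End Echo.

(* Traces are complex numbers, so both bounds are written in R[i].  In the
   order of R[i], x <= y means that y - x is a nonnegative real.  Since
   x / 0 = 0, the fraction in [pcrb] vanishes when \tr (A4 *m W) = 0. *)
Definition pcrb (R : realType) n (J : R) (alpha : R[i]) (L : nat)
    (sigma_s : R) (A1 A2 A3 A4 W : 'M[R[i]]_n) : R[i] :=
  1 / (J%:C + 2 * `|alpha| ^+ 2 * L%:R / (sigma_s ^+ 2)%:C
              * (\tr ((A1 + A2) *m W)
                 - `|\tr (A3 *m W)| ^+ 2 / \tr (A4 *m W))).

Definition pcrb_upper (R : realType) n (J : R) (alpha : R[i]) (L : nat)
    (sigma_s : R) (A1 W : 'M[R[i]]_n) : R[i] :=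
  1 / (J%:C + 2 * `|alpha| ^+ 2 * L%:R / (sigma_s ^+ 2)%:C * \tr (A1 *m W)).

(* Main.v *)
(* The two denominators differ by a nonnegative multiple of
   tr(A2 W) - |tr(A3 W)|^2 / tr(A4 W), which is nonnegative by Cauchy-Schwarz
   for the semi-inner product (u, v) |-> int v^H W u p_Theta applied to the
   derivative of a and to a.  To compare the reciprocals, the smaller
   denominator must be positive.  Since tr(A1 W) >= 0, it suffices that the
   Fisher information of the prior is positive.  With w_k = p_k f_k and
   s_k = (theta - theta_k) / sigma_k^2, the integrand of rho equals
   sum_k w_k s_k^2 - (sum_k w_k s_k)^2 / sum_k w_k.  The first term has
   integral at most sum_k p_k / sigma_k^2, and the second one is positive to the
   right of all the means. *)

Require Import Defs.
From mathcomp Require Import all_boot all_order all_algebra.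
From mathcomp Require Import all_classical all_reals all_analysis.
From mathcomp Require Import spectral measurable_realfun ring lra.
Import Order.TTheory GRing.Theory Num.Theory.
Import numFieldNormedType.Exports.
Local Open Scope ring_scope.
Local Open Scope complex_scope.
Local Open Scope sesquilinear_scope.
Set Implicit Arguments.
Unset Strict Implicit.
Unset Printing Implicit Defensive.

(** * Integrable real functions on the line *)

Section RealIntegral.
Variable R : realType.
Let mu := @lebesgue_measure R.

Definition rintegrable (f : R -> R) := mu.-integrable setT (EFin \o f).

Lemma rintegrableD (f g : R -> R) :
  rintegrable f -> rintegrable g -> rintegrable (fun t => f t + g t).
Proof.
move=> fi gi; rewrite /rintegrable.
rewrite (_ : _ \o _ = (EFin \o f) \+ (EFin \o g))%E; last by apply/funext.
exact: integrableD.
Qed.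

Lemma rintegrableZ (k : R) (f : R -> R) :
  rintegrable f -> rintegrable (fun t => k * f t).
Proof. by move=> fi; exact: (integrableZl _ k fi). Qed.

Lemma rintegrable_sum (I : Type) (s : seq I) (F : I -> R -> R) :
  (forall i, rintegrable (F i)) -> rintegrable (fun t => \sum_(i <- s) F i t).
Proof.
move=> Fi; elim: s => [|i s IH].
  by under eq_fun do rewrite big_nil; exact: integrable0.
under eq_fun do rewrite big_cons.
exact: rintegrableD.
Qed.

Lemma Rintegral_sum (I : Type) (s : seq I) (F : I -> R -> R) :
  (forall i, rintegrable (F i)) ->
  \int[mu]_t (\sum_(i <- s) F i t) = \sum_(i <- s) \int[mu]_t F i t.
Proof.
move=> Fi; elim: s => [|i s IH].
  under eq_Rintegral do rewrite big_nil.
  by rewrite Rintegral_cst// mul0r big_nil.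
under eq_Rintegral do rewrite big_cons.
by rewrite RintegralD//; [rewrite big_cons IH|exact: Fi|exact: rintegrable_sum].
Qed.

(** If the integral vanished, [f] would be zero almost everywhere, so the interval from [a] to [b]
    would lie in a null set although its measure is [b - a > 0]. *)
Lemma Rintegral_gt0 (f : R -> R) (a b : R) :
  a < b -> rintegrable f -> (forall t, 0 <= f t) ->
  (forall t, a <= t <= b -> 0 < f t) -> 0 < \int[mu]_t f t.
Proof.
move=> ab fi f0 fpos; rewrite lt_neqAle Rintegral_ge0// andbT.
apply/eqP => /esym int0.
have fin : (\int[mu]_t (f t)%:E)%E \is a fin_num by exact: integrable_fin_num.
have intE : (\int[mu]_t `|(f t)%:E| = 0)%E.
  under eq_integral do rewrite abse_EFin ger0_norm//.
  by rewrite -[LHS]fineK// [X in X%:E]int0.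
have /ae_eq_integral_abs := intE.
case=> //; first exact: measurable_int fi.
move=> N [mN N0 subN].
have : (mu `[a, b]%classic <= mu N)%E.
  apply: le_measure; rewrite ?inE//.
  move=> t /=; rewrite in_itv/= => /fpos ft; apply: subN => /= /(_ I) /eqP.
  by rewrite eqe gt_eqF.
have -> : mu N = 0%E := N0.
rewrite /mu lebesgue_measure_itv/= lte_fin ab -EFinB lee_fin.
by rewrite subr_le0 leNgt ab.
Qed.

End RealIntegral.

(** * Integrals of complex functions and matrices, and a Cauchy-Schwarz inequality *)

Section ComplexIntegral.
Variable R : realType.
Implicit Types (f g h : R -> R[i]) (z : R[i]).
Definition cintegrable f :=
  rintegrable (fun t => complex.Re (f t)) /\
  rintegrable (fun t => complex.Im (f t)).

Lemma cintegrableD f g :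
  cintegrable f -> cintegrable g -> cintegrable (fun t => f t + g t).
Proof.
move=> [fr fi] [gr gi]; split.
  rewrite (_ : (fun t => _) = fun t => complex.Re (f t) + complex.Re (g t)).
    exact: rintegrableD.
  by apply/funext => t; case: (f t) (g t) => [? ?] [].
rewrite (_ : (fun t => _) = fun t => complex.Im (f t) + complex.Im (g t)).
  exact: rintegrableD.
by apply/funext => t; case: (f t) (g t) => [? ?] [].
Qed.

Lemma cintegrableZ z f : cintegrable f -> cintegrable (fun t => z * f t).
Proof.
case: z => a b [fr fi]; split.
  rewrite (_ : (fun t => _) =
      fun t => a * complex.Re (f t) + (- b) * complex.Im (f t)).
    by apply: rintegrableD; exact: rintegrableZ.
  by apply/funext => t; case: (f t) => x y /=; rewrite mulNr.
rewrite (_ : (fun t => _) =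
    fun t => a * complex.Im (f t) + b * complex.Re (f t)).
  by apply: rintegrableD; exact: rintegrableZ.
by apply/funext => t; case: (f t) => x y.
Qed.

Lemma cintegrable_conj f : cintegrable f -> cintegrable (fun t => (f t)^*%R).
Proof.
move=> [fr fi]; split.
  by rewrite (_ : (fun t => _) = fun t => complex.Re (f t));
    last by apply/funext => t; case: (f t).
rewrite (_ : (fun t => _) = fun t => -1 * complex.Im (f t)).
  exact: rintegrableZ.
by apply/funext => t; case: (f t) => x y /=; rewrite mulN1r.
Qed.

Lemma cintegrable_sum (I : Type) (s : seq I) (F : I -> R -> R[i]) :
  (forall i, cintegrable (F i)) -> cintegrable (fun t => \sum_(i <- s) F i t).
Proof.
move=> Fi; elim: s => [|i s IH].
  under eq_fun do rewrite big_nil.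
  by split; exact: integrable0.
under eq_fun do rewrite big_cons.
exact: cintegrableD.
Qed.

Lemma cintegralD f g : cintegrable f -> cintegrable g ->
  cintegral (fun t => f t + g t) = cintegral f + cintegral g.
Proof.
move=> [fr fi] [gr gi]; rewrite /cintegral.
under eq_Rintegral => t _.
  rewrite (_ : complex.Re _ = complex.Re (f t) + complex.Re (g t)); last first.
    by case: (f t) (g t) => [? ?] [].
  over.
under [X in _ +i* X = _]eq_Rintegral => t _.
  rewrite (_ : complex.Im _ = complex.Im (f t) + complex.Im (g t)); last first.
    by case: (f t) (g t) => [? ?] [].
  over.
by rewrite !RintegralD.
Qed.

Lemma cintegralZ z f : cintegrable f ->
  cintegral (fun t => z * f t) = z * cintegral f.
Proof.
case: z => a b [fr fi]; rewrite /cintegral.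
under eq_Rintegral => t _.
  rewrite (_ : complex.Re _ = a * complex.Re (f t) + (- b) * complex.Im (f t));
    last by case: (f t) => x y /=; rewrite mulNr.
  over.
under [X in _ +i* X = _]eq_Rintegral => t _.
  rewrite (_ : complex.Im _ = a * complex.Im (f t) + b * complex.Re (f t));
    last by case: (f t).
  over.
by rewrite !RintegralD ?RintegralZl//; try exact: rintegrableZ; rewrite mulNr.
Qed.

Lemma cintegral_conj f : cintegrable f ->
  cintegral (fun t => (f t)^*%R) = (cintegral f)^*%R.
Proof.
move=> [fr fi]; rewrite /cintegral /=; congr (_ +i* _).
  by apply: eq_Rintegral => t _; case: (f t).
rewrite -mulN1r -RintegralZl//.
by apply: eq_Rintegral => t _; case: (f t) => x y /=; rewrite mulN1r.
Qed.

Lemma cintegral_sum (I : Type) (s : seq I) (F : I -> R -> R[i]) :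
  (forall i, cintegrable (F i)) ->
  cintegral (fun t => \sum_(i <- s) F i t) = \sum_(i <- s) cintegral (F i).
Proof.
move=> Fi; elim: s => [|i s IH].
  rewrite big_nil /cintegral.
  under eq_Rintegral do rewrite big_nil.
  under [X in _ +i* X = _]eq_Rintegral do rewrite big_nil.
  by rewrite Rintegral_cst// mul0r.
rewrite big_cons -IH -cintegralD//; last exact: cintegrable_sum.
by congr cintegral; apply/funext => t; rewrite big_cons.
Qed.

(** A nonnegative element of [R[i]] is real, so the imaginary part integrates to 0 and only the real
    part is left to bound. *)
Lemma cintegral_ge0 f : (forall t, 0 <= f t) -> 0 <= cintegral f.
Proof.
move=> f0; rewrite lecE /=; apply/andP; split.
  under eq_Rintegral => t _ do rewrite (ger0_Im (f0 t)).
  by rewrite Rintegral_cst// mul0r.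
by apply: Rintegral_ge0 => t _; move: (f0 t); rewrite lecE => /andP[].
Qed.

(* The quadratic polynomial in z is evaluated at its minimiser
   - int g / int h. *)
Lemma cintegral_Cauchy_Schwarz f g h :
  cintegrable f -> cintegrable g -> cintegrable h ->
  (forall t, 0 <= h t) ->
  (forall z t, 0 <= f t + z^* * g t + z * (g t)^* + (z * z^*) * h t) ->
  `|cintegral g| ^+ 2 / cintegral h <= cintegral f.
Proof.
move=> fi gi hi h0 fgh.
have key z : 0 <= cintegral f + z^* * cintegral g + z * (cintegral g)^*
    + (z * z^*) * cintegral h.
  have gci := cintegrable_conj gi.
  rewrite -cintegral_conj// -!cintegralZ//.
  have i1 := cintegrableD fi (cintegrableZ z^*%R gi).
  have i2 := cintegrableD i1 (cintegrableZ z gci).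
  rewrite -cintegralD//; last exact: cintegrableZ.
  rewrite -cintegralD//; last exact: cintegrableZ.
  rewrite -cintegralD//; last exact: cintegrableZ.
  exact: cintegral_ge0.
have H0 : 0 <= cintegral h by exact: cintegral_ge0.
have Hreal : (cintegral h)^*%R = cintegral h.
  by exact/conj_Creal/ger0_real.
move: (key (- (cintegral g / cintegral h))).
move: Hreal; move: (cintegral f) (cintegral g) (cintegral h) => F G H Hreal.
(* When [H = 0], both [z] and the quotient are 0 because [x / 0 = 0], and the polynomial inequality
   is already [0 <= F]. *)
have [->|Hn0] := eqVneq H 0.
  by rewrite invr0 !mulr0 oppr0 rmorph0 !(mul0r, mulr0) !addr0.
have -> : (- (G / H))^*%R = - (G^*%R / H).
  by rewrite rmorphN rmorphM fmorphV /= Hreal.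
(* At this [z] the polynomial takes exactly the value [F - G * G^* / H]. *)
move=> pos; rewrite normCK -subr_ge0; apply: (le_trans pos).
by rewrite le_eqVlt; apply/orP; left; apply/eqP; field.
Qed.

Section Trace.
Variables (n : nat) (F : R -> 'M[R[i]]_n) (W : 'M[R[i]]_n).
Hypothesis Fi : forall i j, cintegrable (fun t => F t i j).

Let mxtrace_mulE t : \tr (F t *m W) = \sum_i \sum_j W j i * F t i j.
Proof.
by apply: eq_bigr => i _; rewrite mxE; apply: eq_bigr => j _; rewrite mulrC.
Qed.

Let entry_cintegrable i j : cintegrable (fun t => W j i * F t i j).
Proof. exact: cintegrableZ. Qed.

Lemma cintegrable_tr : cintegrable (fun t => \tr (F t *m W)).
Proof.
under eq_fun do rewrite mxtrace_mulE.
by do 2![apply: cintegrable_sum => ?].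
Qed.

(** The trace against [W] is a finite linear combination of the entries, so it commutes with the
    entrywise integral. *)
Lemma tr_mxintegral :
  \tr (mxintegral F *m W) = cintegral (fun t => \tr (F t *m W)).
Proof.
under [in RHS]eq_fun do rewrite mxtrace_mulE.
rewrite cintegral_sum; last by move=> i; exact: cintegrable_sum.
apply: eq_bigr => i _; rewrite mxE cintegral_sum//.
by apply: eq_bigr => j _; rewrite mxE mulrC -cintegralZ.
Qed.

End Trace.

End ComplexIntegral.

(** * Bounded measurable functions as multipliers of integrable ones *)

Section BoundedMeasurable.
Variable R : realType.
Implicit Types (f g : R -> R) (F G : R -> R[i]).
Let mu := @lebesgue_measure R.

(** The entries of the steering vectors and of their derivatives lie in this class. It is stable
    under the operations that form the matrix integrands, and its members may multiply an integrable
    density without loss of integrability. *)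
Definition bounded_measurable f :=
  measurable_fun setT f /\ exists M, forall t, `|f t| <= M.

Definition cbounded_measurable F :=
  bounded_measurable (fun t => complex.Re (F t)) /\
  bounded_measurable (fun t => complex.Im (F t)).

Lemma bounded_measurable_cst (k : R) : bounded_measurable (fun=> k).
Proof. by split => //; exists `|k|. Qed.

Lemma bounded_measurableD f g : bounded_measurable f -> bounded_measurable g ->
  bounded_measurable (fun t => f t + g t).
Proof.
move=> [mf [M fM]] [mg [N gN]]; split; first exact: measurable_funD.
by exists (M + N) => t; rewrite (le_trans (ler_normD _ _))// lerD.
Qed.

Lemma bounded_measurableM f g : bounded_measurable f -> bounded_measurable g ->
  bounded_measurable (fun t => f t * g t).
Proof.
move=> [mf [M fM]] [mg [N gN]]; split; first exact: measurable_funM.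
by exists (M * N) => t; rewrite normrM ler_pM.
Qed.

Lemma bounded_measurableN f : bounded_measurable f ->
  bounded_measurable (fun t => - f t).
Proof.
move=> fb; under eq_fun do rewrite -mulN1r.
by apply: bounded_measurableM => //; exact: bounded_measurable_cst.
Qed.

Lemma bounded_measurable_sin f : measurable_fun setT f ->
  bounded_measurable (fun t => sin (f t)).
Proof.
move=> mf; split; last by exists 1 => t; rewrite ler_norml sin_geN1 sin_le1.
apply: measurableT_comp => //; apply: continuous_measurable_fun.
exact: continuous_sin.
Qed.

Lemma bounded_measurable_cos f : measurable_fun setT f ->
  bounded_measurable (fun t => cos (f t)).
Proof.
move=> mf; split; last by exists 1 => t; rewrite ler_norml cos_geN1 cos_le1.
apply: measurableT_comp => //; apply: continuous_measurable_fun.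
exact: continuous_cos.
Qed.

Lemma rintegrable_boundedM f g : bounded_measurable f -> rintegrable g ->
  rintegrable (fun t => g t * f t).
Proof.
move=> [mf [M fM]] gi.
apply: (@integrableMl _ _ _ mu setT measurableT (EFin \o g) f) => //.
(* Boundedness is asked for in filter form: every [x] strictly above some real [M] is a bound. *)
exists M; split; first by rewrite num_real.
by move=> x Mx t _ /=; apply: (le_trans (fM t)); exact: ltW.
Qed.

Lemma cbounded_measurableD F G :
  cbounded_measurable F -> cbounded_measurable G ->
  cbounded_measurable (fun t => F t + G t).
Proof.
move=> [Fr Fi] [Gr Gi]; split.
  rewrite (_ : (fun t => _) = fun t => complex.Re (F t) + complex.Re (G t)).
    exact: bounded_measurableD.
  by apply/funext => t; case: (F t) (G t) => [? ?] [].
rewrite (_ : (fun t => _) = fun t => complex.Im (F t) + complex.Im (G t)).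
  exact: bounded_measurableD.
by apply/funext => t; case: (F t) (G t) => [? ?] [].
Qed.

Lemma cbounded_measurableM F G :
  cbounded_measurable F -> cbounded_measurable G ->
  cbounded_measurable (fun t => F t * G t).
Proof.
move=> [Fr Fi] [Gr Gi]; split.
  rewrite (_ : (fun t => _) = fun t => complex.Re (F t) * complex.Re (G t)
      + - (complex.Im (F t) * complex.Im (G t))).
    apply: bounded_measurableD; first exact: bounded_measurableM.
    by apply: bounded_measurableN; exact: bounded_measurableM.
  by apply/funext => t; case: (F t) (G t) => [? ?] [].
rewrite (_ : (fun t => _) = fun t => complex.Re (F t) * complex.Im (G t)
    + complex.Im (F t) * complex.Re (G t)).
  by apply: bounded_measurableD; exact: bounded_measurableM.
by apply/funext => t; case: (F t) (G t) => [? ?] [].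
Qed.

Lemma cbounded_measurable_conj F : cbounded_measurable F ->
  cbounded_measurable (fun t => (F t)^*%R).
Proof.
move=> [Fr Fi]; split.
  by rewrite (_ : (fun t => _) = fun t => complex.Re (F t));
    last by apply/funext => t; case: (F t).
rewrite (_ : (fun t => _) = fun t => - complex.Im (F t)).
  exact: bounded_measurableN.
by apply/funext => t; case: (F t).
Qed.

Lemma cbounded_measurable_sum (I : Type) (s : seq I) (F : I -> R -> R[i]) :
  (forall i, cbounded_measurable (F i)) ->
  cbounded_measurable (fun t => \sum_(i <- s) F i t).
Proof.
move=> Fb; elim: s => [|i s IH].
  under eq_fun do rewrite big_nil.
  by split; exact: bounded_measurable_cst.
under eq_fun do rewrite big_cons.
exact: cbounded_measurableD.
Qed.

Lemma cintegrable_boundedM F g : cbounded_measurable F -> rintegrable g ->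
  cintegrable (fun t => (g t)%:C * F t).
Proof.
move=> [Fr Fi] gi; split.
  rewrite (_ : (fun t => _) = fun t => g t * complex.Re (F t)).
    exact: rintegrable_boundedM.
  by apply/funext => t; case: (F t) => x y /=; rewrite mul0r subr0.
rewrite (_ : (fun t => _) = fun t => g t * complex.Im (F t)).
  exact: rintegrable_boundedM.
by apply/funext => t; case: (F t) => x y /=; rewrite mul0r addr0.
Qed.

End BoundedMeasurable.

(** * An upper bound on the variance of a normal law *)

Section NormalSecondMoment.
Variables (R : realType) (m s : R).
Hypothesis s_gt0 : 0 < s.
Let mu := @lebesgue_measure R.
Let s_neq0 : s != 0. Proof. by rewrite gt_eqF. Qed.
Let f := normal_pdf m s.

Let is_derive_f (x : R) : is_derive x 1 f (- (x - m) / s ^+ 2 * f x).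
Proof.
have d1 : is_derive x 1 (fun y : R => y - m) 1.
  by have := is_deriveB (is_derive_id x 1) (is_derive_cst m x 1); rewrite subr0.
have d2 : is_derive x 1 (fun y : R => - (2 * s ^+ 2)^-1 * (y - m) ^+ 2)
    (- (x - m) / s ^+ 2).
  apply: (is_derive_eq (is_deriveZ (- (2 * s ^+ 2)^-1) (is_deriveX 2 d1))).
  rewrite /GRing.scale /= expr1.
  by field.
have d3 := is_deriveZ (normal_peak s) (is_derive1_comp (is_derive_expR _) d2).
have fE : f = normal_peak s \*: (expR \o
    (fun y : R => - (2 * s ^+ 2)^-1 * (y - m) ^+ 2)).
  rewrite /f normal_pdfE//; apply/funext => y /=.
  by congr (_ * expR _); field.
rewrite {1}fE; apply: (is_derive_eq d3).
by rewrite fE /= /GRing.scale /=; ring.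
Qed.

(* G' = g, and G decreases across any interval around m, so
   int (x - m)^2 f <= s^2 int f there. *)
Let G x := - s ^+ 2 * ((x - m) * f x).
Let g x := (x - m) ^+ 2 * f x - s ^+ 2 * f x.

Let is_derive_G (x : R) : is_derive x 1 G (g x).
Proof.
have d1 : is_derive x 1 (fun y : R => y - m) 1.
  by have := is_deriveB (is_derive_id x 1) (is_derive_cst m x 1); rewrite subr0.
apply: (is_derive_eq (is_deriveZ (- s ^+ 2) (is_deriveM d1 (is_derive_f x)))).
rewrite /GRing.scale /= /g.
by field.
Qed.

Let cf : continuous f. Proof. exact: continuous_normal_pdf. Qed.

Let ch : continuous (fun x => (x - m) ^+ 2 * f x).
Proof.
move=> x; apply: cvgM; last exact: cf.
apply: (cvg_comp (fun y : R => y - m) (fun y => y ^+ 2)).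
  by apply: cvgB; [exact: cvg_id|exact: cvg_cst].
exact: sqr_continuous.
Qed.

Let cg : continuous g.
Proof.
move=> x; apply: cvgB; first exact: ch.
by apply: cvgM; [exact: cvg_cst|exact: cf].
Qed.

Let cG : continuous G.
Proof.
move=> x; apply/differentiable_continuous/derivable1_diffP.
by have [] := is_derive_G x.
Qed.

Let f_ge0 x : 0 <= f x. Proof. exact: normal_pdf_ge0. Qed.

Let h_ge0 x : 0 <= (x - m) ^+ 2 * f x.
Proof. by rewrite mulr_ge0// sqr_ge0. Qed.

Let integral_itv_le (a b : R) : a < m -> m < b ->
  (\int[mu]_(x in `[a, b]%classic) ((x - m) ^+ 2 * f x)%:E <= (s ^+ 2)%:E)%E.
Proof.
move=> am mb.
have ab : a < b by exact: lt_trans mb.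
have compact_int (k : R -> R) : continuous k ->
    mu.-integrable `[a, b]%classic (EFin \o k).
  move=> ck; apply: continuous_compact_integrable; first exact: segment_compact.
  exact: continuous_subspaceT.
have FTC : (\int[mu]_(x in `[a, b]%classic) (g x)%:E = (G b)%:E - (G a)%:E)%E.
  apply: continuous_FTC2 => //.
  - exact: continuous_subspaceT.
  - split.
    + by move=> x _; have [] := is_derive_G x.
    + exact/cvg_at_right_filter/cG.
    + exact/cvg_at_left_filter/cG.
  - by move=> x _; rewrite derive1E; have [_ ->] := is_derive_G x.
have -> : (\int[mu]_(x in `[a, b]%classic) ((x - m) ^+ 2 * f x)%:E =
    \int[mu]_(x in `[a, b]%classic) ((g x)%:E + (s ^+ 2 * f x)%:E))%E.
  by apply: eq_integral => x _; rewrite -EFinD /g subrK.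
have cs : continuous (fun x => s ^+ 2 * f x).
  by move=> x; apply: cvgM; [exact: cvg_cst|exact: cf].
rewrite integralD//; [|exact: compact_int|exact: compact_int].
rewrite FTC -[leRHS]add0e; apply: leeD.
  (* The boundary term is nonpositive: [G b <= 0 <= G a], since [a < m < b]. *)
  rewrite -EFinB lee_fin /G subr_le0.
  rewrite !mulNr lerN2 ler_pM2l ?exprn_gt0//.
  apply: (@le_trans _ _ 0).
    by rewrite mulr_le0_ge0// subr_le0 ltW.
  by rewrite mulr_ge0// subr_ge0 ltW.
(* The remaining integral only grows when extended to the whole line, where [f] has mass 1. *)
apply: (@le_trans _ _ (\int[mu]_x (s ^+ 2 * f x)%:E))%E.
  apply: ge0_subset_integral => //.
    by apply/measurable_EFinP; exact: continuous_measurable_fun.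
  by move=> x _; rewrite lee_fin mulr_ge0// sqr_ge0.
under eq_integral do rewrite EFinM.
rewrite integralZl//; last exact: integrable_normal_pdf.
by rewrite integral_normal_pdf mule1.
Qed.

(** Monotone convergence carries the bound on intervals around [m] over to the line. Since the
    integral is an extended real, the bound also gives integrability of the second moment later
    on. *)
Lemma normal_second_moment_le :
  (\int[mu]_x ((x - m) ^+ 2 * normal_pdf m s x)%:E <= (s ^+ 2)%:E)%E.
Proof.
(* The successor keeps [m] strictly inside the interval already for [n = 0]. *)
pose F n : set R := `[m - n.+1%:R, m + n.+1%:R]%classic.
have FT : (\bigcup_n F n = setT)%classic.
  apply/seteqP; split => // x _ /=.
  exists (Num.truncn `|x - m|) => //=.
  rewrite /F /= in_itv/=.
  have := truncnS_gt `|x - m|.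
  rewrite ltr_norml => /andP[h1 h2].
  by apply/andP; split; lra.
have mh : measurable_fun setT (fun x : R => ((x - m) ^+ 2 * f x)%:E).
  by apply/measurable_EFinP; exact: continuous_measurable_fun.
have ndF : nondecreasing_seq F.
  move=> i j ij; rewrite subsetEset => x; rewrite /F /= !in_itv/=.
  have : i.+1%:R <= j.+1%:R :> R by rewrite ler_nat.
  by move=> ? /andP[? ?]; apply/andP; split; lra.
have cvgF : (\int[mu]_(x in F i) ((x - m) ^+ 2 * f x)%:E @[i --> \oo] -->
    \int[mu]_(x in \bigcup_i F i) ((x - m) ^+ 2 * f x)%:E)%E%classic.
  apply: ge0_nondecreasing_set_cvg_integral => //.
  - by move=> i; exact: measurable_itv.
  - by move=> i; exact: measurable_funTS.
  - by move=> i x _; rewrite lee_fin.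
rewrite FT in cvgF.
rewrite -(cvg_lim _ cvgF)//; apply: lime_le; first exact: cvgP cvgF.
apply: nearW => n; apply: integral_itv_le.
  by rewrite ltrBlDr ltrDl.
by rewrite ltrDl.
Qed.

End NormalSecondMoment.

(** * Boundedness of the steering vectors and of their derivatives *)

Section Steering.
Variables (R : realType) (N : nat) (d lam c : R).
Let v := steering N d lam c.

(** All the constants of the array are absorbed into one real factor [k]; the bounds on an entry and
    on its derivative rest on this form alone. *)
Lemma steering_phase n : exists k, forall t, v t n 0 = expi (k * sin t).
Proof.
exists (- (pi * d * (N%:R - 2 * n.+1%:R + 1) * c / lam)) => t.
by rewrite mxE mulNr; congr (expi (- _)); rewrite mulrAC.
Qed.

Lemma cbounded_steering n : cbounded_measurable (fun t => v t n 0).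
Proof.
have [k vE] := steering_phase n.
have mk : measurable_fun setT (fun t : R => k * sin t).
  by apply: measurable_funM => //; exact: (bounded_measurable_sin _).1.
under eq_fun do rewrite vE.
by split; [exact: bounded_measurable_cos|exact: bounded_measurable_sin].
Qed.

(** By the chain rule the real and imaginary parts have derivatives
    [- sin (k * sin t) * (k * cos t)] and [cos (k * sin t) * (k * cos t)], which are products of
    bounded functions. *)
Lemma cbounded_mxderive_steering n :
  cbounded_measurable (fun t => mxderive v t n 0).
Proof.
have [k vE] := steering_phase n.
have mk : measurable_fun setT (fun t : R => k * sin t).
  by apply: measurable_funM => //; exact: (bounded_measurable_sin _).1.
have dk (t : R) : is_derive t 1 (fun u : R => k * sin u) (k * cos t).
  exact: (is_deriveZ k (is_derive_sin t)).
have bk : bounded_measurable (fun t : R => k * cos t).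
  apply: bounded_measurableM; first exact: bounded_measurable_cst.
  exact: bounded_measurable_cos.
split.
  under eq_fun => t.
    rewrite mxE /=.
    rewrite (_ : (fun u => complex.Re _) = cos \o (fun u => k * sin u));
      last by apply/funext => u; rewrite vE.
    rewrite derive1E.
    have dcos := is_derive1_comp (is_derive_cos _) (dk t).
    rewrite (@derive_val _ _ _ _ _ _ _ dcos).
    over.
  apply: bounded_measurableM => //; apply: bounded_measurableN.
  exact: bounded_measurable_sin.
under eq_fun => t.
  rewrite mxE /=.
  rewrite (_ : (fun u => complex.Im _) = sin \o (fun u => k * sin u));
    last by apply/funext => u; rewrite vE.
  rewrite derive1E.
  have dsin := is_derive1_comp (is_derive_sin _) (dk t).
  rewrite (@derive_val _ _ _ _ _ _ _ dsin).
  over.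
by apply: bounded_measurableM => //; exact: bounded_measurable_cos.
Qed.

End Steering.

(** * The semi-inner product defined by [W] *)

Section QuadraticForms.
Variables (R : realType) (n : nat) (W : 'M[R[i]]_n).
Hypothesis W_psd : psdmx W.

(** Cyclicity of the trace leaves a one by one matrix; this is how the traces of the theorem become
    values of the form of [W]. *)
Lemma mxtrace_outer (z : R[i]) (u v : 'cV[R[i]]_n) :
  \tr ((z *: (u *m v ^t* )) *m W) = z * (v ^t* *m W *m u) 0 0.
Proof.
by rewrite -scalemxAl mxtraceZ -mulmxA mxtrace_mulC trace_mx11.
Qed.

Lemma psdmx_form_conj (u v : 'cV[R[i]]_n) :
  (u ^t* *m W *m v) 0 0 = ((v ^t* *m W *m u) 0 0)^*%R.
Proof.
have [/sesquiP WE _] := W_psd.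
have -> : ((v ^t* *m W *m u) 0 0)^*%R = ((v ^t* *m W *m u) ^t* ) 0 0.
  by rewrite !mxE.
rewrite !trmx_mul !map_mxM/= trmxCK mulmxA.
by rewrite [in LHS]WE expr0 scale1r.
Qed.

(** This is the form of [W] at [u + z *: v], expanded into the polynomial in [z] that
    [cintegral_Cauchy_Schwarz] takes as its pointwise hypothesis. *)
Lemma psdmx_form_expand (z : R[i]) (u v : 'cV[R[i]]_n) :
  0 <= (u ^t* *m W *m u) 0 0 + z^*%R * (v ^t* *m W *m u) 0 0
     + z * ((v ^t* *m W *m u) 0 0)^*%R + z * z^*%R * (v ^t* *m W *m v) 0 0.
Proof.
have [_ /(_ (u + z *: v))] := W_psd.
have -> : (u + z *: v) ^t* = u ^t* + z^*%R *: v ^t*.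
  by apply/matrixP => i j; rewrite !mxE rmorphD rmorphM.
rewrite !(mulmxDl, mulmxDr) -!(scalemxAl, scalemxAr) -psdmx_form_conj.
have addE (A B : 'M[R[i]]_1) : (A + B) 0 0 = A 0 0 + B 0 0 by rewrite mxE.
have scaleE y (A : 'M[R[i]]_1) : (y *: A) 0 0 = y * A 0 0 by rewrite mxE.
by rewrite !(addE, scaleE) [z * z^*%R]mulrC -mulrA addrA.
Qed.

End QuadraticForms.

(* x, y and z are tied to their values by equations because rewriting with these
   equations in a goal about matA2, matA3 and matA4 unfolds the integrals. *)
Lemma sqr_norm_div_scale_le (R : realType) (n : nat) (f g h x y z : R[i]) :
  (0 < n)%N -> x = n%:R * f -> y = n%:R * g -> z = n%:R * h ->
  `|g| ^+ 2 / h <= f -> `|y| ^+ 2 / z <= x.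
Proof.
move=> n_gt0 -> -> -> gh_le_f.
have n_neq0 : n%:R != 0 :> R[i] by rewrite pnatr_eq0 -lt0n.
rewrite normrM exprMn normr_nat expr2 invfM mulrACA mulfK//.
by rewrite ler_pM2l ?ltr0n.
Qed.

(** * The trace inequalities for the echo matrices *)

Section EchoInformation.
Variables (R : realType) (Nt Nr : nat).
Variables (a : R -> 'cV[R[i]]_Nt) (b : R -> 'cV[R[i]]_Nr) (p : R -> R).
Variable W : 'M[R[i]]_Nt.
Hypothesis a_bounded : forall i, cbounded_measurable (fun t => a t i 0).
Hypothesis da_bounded :
  forall i, cbounded_measurable (fun t => mxderive a t i 0).
Hypothesis db_bounded :
  forall i, cbounded_measurable (fun t => mxderive b t i 0).
Hypothesis p_ge0 : forall t, 0 <= p t.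
Hypothesis p_integrable : rintegrable p.
Hypothesis W_psd : psdmx W.

Let pC_ge0 t : 0 <= (p t)%:C. Proof. by rewrite ler0c. Qed.

(** The weight [w] is the squared norm of the derivative of [b] for [matA1], and the constant 1 for
    the other three matrices. *)
Let outer_cintegrable (w : R -> R[i]) (u v : R -> 'cV[R[i]]_Nt) :
  cbounded_measurable w ->
  (forall i, cbounded_measurable (fun t => u t i 0)) ->
  (forall i, cbounded_measurable (fun t => v t i 0)) ->
  forall i j, cintegrable
    (fun t => ((w t * (p t)%:C) *: (u t *m (v t) ^t* )) i j).
Proof.
move=> wb ub vb i j.
rewrite (_ : (fun t => _) =
    fun t => (p t)%:C * (w t * (u t i 0 * (v t j 0)^*%R))); last first.
  by apply/funext => t; rewrite !mxE big_ord1 !mxE; ring.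
apply: cintegrable_boundedM => //; apply: cbounded_measurableM => //.
by apply: cbounded_measurableM => //; exact: cbounded_measurable_conj.
Qed.

Let one_bounded : cbounded_measurable (fun=> 1 : R[i]).
Proof. by split; exact: bounded_measurable_cst. Qed.

Let outer_form (u v : R -> 'cV[R[i]]_Nt) :
  (forall i, cbounded_measurable (fun t => u t i 0)) ->
  (forall i, cbounded_measurable (fun t => v t i 0)) ->
  cintegrable (fun t => (p t)%:C * ((v t) ^t* *m W *m u t) 0 0) /\
  \tr (mxintegral (fun t => (p t)%:C *: (u t *m (v t) ^t* )) *m W) =
  cintegral (fun t => (p t)%:C * ((v t) ^t* *m W *m u t) 0 0).
Proof.
move=> ub vb.
have uvi i j : cintegrable (fun t => ((p t)%:C *: (u t *m (v t) ^t* )) i j).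
  have := outer_cintegrable one_bounded ub vb i j.
  by under eq_fun do rewrite mul1r.
split.
  by under eq_fun do rewrite -mxtrace_outer; exact: cintegrable_tr.
rewrite tr_mxintegral//.
by congr cintegral; apply/funext => t; rewrite mxtrace_outer.
Qed.

(** The trace is the integral of a squared norm times the density times the form of [W] at [a t],
    all three nonnegative. *)
Lemma tr_matA1_ge0 : 0 <= \tr (matA1 a b p *m W).
Proof.
have sb : cbounded_measurable (fun t => sqnorm2 (mxderive b t)).
  apply: cbounded_measurable_sum => i.
  under eq_fun do rewrite normCK.
  by apply: cbounded_measurableM => //; exact: cbounded_measurable_conj.
rewrite tr_mxintegral; last exact: outer_cintegrable.
apply: cintegral_ge0 => t; rewrite mxtrace_outer.
rewrite mulr_ge0//; last by have [_] := W_psd.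
by rewrite mulr_ge0// sumr_ge0// => i _; rewrite exprn_ge0.
Qed.

(** The common factor [Nr] cancels first. Then the pointwise polynomial is [p t] times the form of
    [W] at the derivative of [a] plus [z] times [a]. *)
Lemma tr_matA3_Cauchy_Schwarz : (0 < Nr)%N ->
  `|\tr (matA3 Nr a p *m W)| ^+ 2 / \tr (matA4 Nr a p *m W) <=
  \tr (matA2 Nr a p *m W).
Proof.
move=> Nr_gt0.
have [fi tr2] := outer_form da_bounded da_bounded.
have [gi tr3] := outer_form da_bounded a_bounded.
have [hi tr4] := outer_form a_bounded a_bounded.
have trZ (A : 'M[R[i]]_Nt) : \tr ((Nr%:R *: A) *m W) = Nr%:R * \tr (A *m W).
  by rewrite -scalemxAl mxtraceZ.
have e2 : \tr (matA2 Nr a p *m W) = _ := etrans (trZ _) (congr1 _ tr2).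
have e3 : \tr (matA3 Nr a p *m W) = _ := etrans (trZ _) (congr1 _ tr3).
have e4 : \tr (matA4 Nr a p *m W) = _ := etrans (trZ _) (congr1 _ tr4).
apply: (sqr_norm_div_scale_le Nr_gt0 e2 e3 e4).
apply: cintegral_Cauchy_Schwarz => //.
  by move=> t; rewrite mulr_ge0//; have [_] := W_psd.
move=> z t.
have pconj x : ((p t)%:C * x)^*%R = (p t)%:C * x^*%R.
  by rewrite rmorphM; congr (_ * _); exact/conj_Creal/ger0_real.
rewrite pconj.
rewrite (_ : _ + _ = (p t)%:C * (((mxderive a t) ^t* *m W *m mxderive a t) 0 0
  + z^*%R * ((a t) ^t* *m W *m mxderive a t) 0 0
  + z * (((a t) ^t* *m W *m mxderive a t) 0 0)^*%R
  + z * z^*%R * ((a t) ^t* *m W *m a t) 0 0)); last first.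
  by ring.
by rewrite mulr_ge0// psdmx_form_expand.
Qed.

End EchoInformation.

(** A form of Lagrange's identity: it turns the double sum in [prior_rho] into products of single
    sums. *)
Lemma sum_weighted_sqr_diff (R : comNzRingType) (I : finType) (w s : I -> R) :
  \sum_i \sum_j w i * w j * (s i - s j) ^+ 2 =
  2 * ((\sum_i w i) * (\sum_i w i * s i ^+ 2) - (\sum_i w i * s i) ^+ 2).
Proof.
set A := \sum_i w i; set B := \sum_i w i * s i ^+ 2; set C := \sum_i w i * s i.
(* With the product written in both orders, the identity holds separately for each pair [i], [j]. *)
transitivity (A * B + B * A - 2 * (C * C)); last by ring.
rewrite !big_distrlr/= mulr_sumr -big_split -sumrB; apply: eq_bigr => i _.
rewrite /= mulr_sumr -big_split -sumrB; apply: eq_bigr => j _ /=.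
by ring.
Qed.

(** * Positivity of the Fisher information of the Gaussian mixture *)

Section PriorFisher.
Variables (R : realType) (K : nat) (p mean sigma : 'I_K -> R).
Hypothesis p_ge0 : forall k, 0 <= p k.
Hypothesis p_sum : \sum_k p k = 1.
Hypothesis sigma_gt0 : forall k, 0 < sigma k.
Let mu := @lebesgue_measure R.

Let f k := normal_pdf (mean k) (sigma k).
Let w k t := p k * f k t.
(** [- s k] is the logarithmic derivative of the component [f k]. Hence [- M1] is the derivative of
    the density [S], and [Q] is the integrand of its Fisher information. *)
Let s k t := (t - mean k) / sigma k ^+ 2.
Let S t := \sum_k w k t.
Let M1 t := \sum_k w k t * s k t.
Let M2 t := \sum_k w k t * s k t ^+ 2.
Let Q t := M1 t ^+ 2 / S t.

Let sigma_neq0 k : sigma k != 0. Proof. by rewrite gt_eqF. Qed.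

(** Single weights may be zero, but a vanishing sum would force all of them to be zero, against
    their total of 1. *)
Let mixture_gt0 (g : 'I_K -> R) : (forall k, 0 < g k) -> 0 < \sum_k p k * g k.
Proof.
move=> g0; have pg0 k : true -> 0 <= p k * g k by rewrite mulr_ge0// ltW.
rewrite lt_neqAle sumr_ge0// andbT eq_sym; apply/negP.
rewrite psumr_eq0// => /allP pg; move: p_sum.
rewrite big1 => [/eqP|k _]; first by rewrite eq_sym oner_eq0.
have := pg k (mem_index_enum k).
by rewrite mulf_eq0 (gt_eqF (g0 k)) orbF => /eqP.
Qed.

Let f_gt0 k t : 0 < f k t.
Proof. by rewrite /f normal_pdfE// mulr_gt0 ?normal_peak_gt0 ?expR_gt0. Qed.

Let S_gt0 t : 0 < S t. Proof. exact: mixture_gt0. Qed.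

Lemma gauss_mixture_ge0 t : 0 <= gauss_mixture p mean sigma t.
Proof. exact: ltW. Qed.

Lemma rintegrable_gauss_mixture : rintegrable (gauss_mixture p mean sigma).
Proof.
apply: rintegrable_sum => k; apply: rintegrableZ.
exact: integrable_normal_pdf.
Qed.

Let measurable_w k : measurable_fun setT (w k).
Proof. by apply: measurable_funM => //; exact: measurable_normal_pdf. Qed.

Let measurable_s k : measurable_fun setT (s k).
Proof. by apply: measurable_funM => //; exact: measurable_funB. Qed.

(** The integrand is [p k / sigma k ^+ 4] times the second central moment density, whose integral is
    at most [sigma k ^+ 2]. *)
Let second_moment k :
  rintegrable (fun t => w k t * s k t ^+ 2) /\
  \int[mu]_t (w k t * s k t ^+ 2) <= p k / sigma k ^+ 2.
Proof.
have mh : measurable_fun setT (fun t : R => (t - mean k) ^+ 2 * f k t).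
  apply: measurable_funM; last exact: measurable_normal_pdf.
  by apply: measurable_funX; exact: measurable_funB.
have h_ge0 t : 0 <= (t - mean k) ^+ 2 * f k t.
  by rewrite mulr_ge0 ?sqr_ge0// ltW.
have le_var := normal_second_moment_le (mean k) (sigma_gt0 k).
have hi : rintegrable (fun t : R => (t - mean k) ^+ 2 * f k t).
  apply/integrableP; split; first exact/measurable_EFinP.
  under eq_integral do rewrite abse_EFin ger0_norm//.
  by rewrite (le_lt_trans le_var)// ltry.
have -> : (fun t => w k t * s k t ^+ 2) =
    fun t => p k / sigma k ^+ 4 * ((t - mean k) ^+ 2 * f k t).
  by apply/funext => t; rewrite /w /s; field.
split; first exact: rintegrableZ.
rewrite RintegralZl//.
have -> : p k / sigma k ^+ 2 = p k / sigma k ^+ 4 * sigma k ^+ 2 by field.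
apply: ler_wpM2l; first by rewrite divr_ge0 ?exprn_ge0 ?(ltW (sigma_gt0 k)).
by rewrite -lee_fin fineK//; exact: integrable_fin_num.
Qed.

Let M2_integrable : rintegrable M2.
Proof. by apply: rintegrable_sum => k; have [] := second_moment k. Qed.

Let rho_integrandE t :
  (\sum_k1 \sum_k2 p k1 * p k2 * f k1 t * f k2 t
     * ((t - mean k1) / sigma k1 ^+ 2 - (t - mean k2) / sigma k2 ^+ 2) ^+ 2)
  / (2 * \sum_k p k * f k t) = M2 t - Q t.
Proof.
rewrite (_ : M2 t - Q t = 2 * (S t * M2 t - M1 t ^+ 2) / (2 * S t)); last first.
  by rewrite /Q; field; rewrite gt_eqF.
rewrite -sum_weighted_sqr_diff; congr (_ / _).
by apply: eq_bigr => i _; apply: eq_bigr => j _; rewrite /w /s; ring.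
Qed.

Let Q_ge0 t : 0 <= Q t.
Proof. by rewrite divr_ge0 ?sqr_ge0// ltW. Qed.

(** The difference is the integrand of [prior_rho], a sum of nonnegative terms over a positive
    number. It provides the domination that makes [Q] integrable. *)
Let Q_le_M2 t : Q t <= M2 t.
Proof.
rewrite -subr_ge0 -rho_integrandE divr_ge0//; last first.
  by rewrite mulr_ge0// (ltW (S_gt0 t)).
apply: sumr_ge0 => i _; apply: sumr_ge0 => j _.
apply: mulr_ge0 (sqr_ge0 _).
by rewrite (mulr_ge0 _ (ltW _))// (mulr_ge0 _ (ltW _))// mulr_ge0.
Qed.

Let Q_integrable : rintegrable Q.
Proof.
apply: le_integrable M2_integrable => //.
  apply/measurable_EFinP; apply: measurable_funM.
    apply: measurable_funX; apply: measurable_sum => k.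
    by apply: measurable_funM; [exact: measurable_w|exact: measurable_s].
  (* The inverse of the positive function [S] is written as a real power to obtain its
     measurability. *)
  rewrite (_ : (fun t => _) = fun t => S t `^ (-1)); last first.
    by apply/funext => t; rewrite powR_inv1 ?(ltW (S_gt0 t)).
  by apply: (measurableT_comp (measurable_powR _)); apply: measurable_sum => k;
    exact: measurable_w.
move=> t _ /=; rewrite lee_fin ger0_norm// ger0_norm//.
exact: le_trans (Q_le_M2 t).
Qed.

Lemma prior_fisher_gt0 : 0 < prior_fisher p mean sigma.
Proof.
have -> : prior_fisher p mean sigma =
    \sum_k p k / sigma k ^+ 2 - \int[mu]_t M2 t + \int[mu]_t Q t.
  rewrite /prior_fisher /prior_rho.
  under eq_Rintegral do rewrite rho_integrandE.
  by rewrite RintegralB// opprB addrA addrAC.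
(* [c] is at least every mean, so between [c + 1] and [c + 2] all [s k] are positive, and with them
   [M1] and [Q]. *)
pose c := \sum_k `|mean k|.
have Q_gt0 : 0 < \int[mu]_t Q t.
  apply: (@Rintegral_gt0 _ Q (c + 1) (c + 2)) => // [|t /andP[ct _]].
    by rewrite ltrD2l ltr1n.
  rewrite divr_gt0// exprn_gt0//.
  rewrite /M1; under eq_bigr do rewrite -mulrA.
  apply: mixture_gt0 => k; rewrite mulr_gt0// divr_gt0 ?exprn_gt0// subr_gt0.
  apply: lt_le_trans ct; rewrite (le_lt_trans (ler_norm _))//.
  by rewrite /c (bigD1 k)//= ltr_pwDr// lerDl sumr_ge0.
(* What remains beside the integral of [Q] is nonnegative, term by term, by the second moment
   bounds. *)
rewrite ltr_wpDl// subr_ge0 Rintegral_sum; last first.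
  by move=> k; have [] := second_moment k.
by apply: ler_sum => k _; have [] := second_moment k.
Qed.

End PriorFisher.

(** * From the trace inequalities to the comparison of the two bounds *)

Lemma inv_information_le (C : numFieldType) (J c t1 t2 q : C) :
  0 < J -> 0 <= c -> 0 <= t1 -> q <= t2 ->
  1 / (J + c * (t1 + t2 - q)) <= 1 / (J + c * t1).
Proof.
move=> J_gt0 c_ge0 t1_ge0 q_le.
have upper_gt0 : 0 < J + c * t1 by rewrite ltr_wpDr ?mulr_ge0.
have le_denom : J + c * t1 <= J + c * (t1 + t2 - q).
  by rewrite lerD2l ler_wpM2l// -addrA lerDl subr_ge0.
by rewrite !div1r lef_pV2// posrE// (lt_le_trans upper_gt0).
Qed.

Theorem proposition1 (R : realType) (Nt Nr L K : nat)
    (d lam r sigma_s hB : R) (alpha : R[i])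
    (p mean sigma : 'I_K -> R) (W : 'M[R[i]]_Nt)
    (Nt_ge1 : (1 <= Nt)%N) (Nr_ge1 : (1 <= Nr)%N)
    (L_ge1 : (1 <= L)%N) (K_ge1 : (1 <= K)%N)
    (d_gt0 : 0 < d) (lam_gt0 : 0 < lam) (r_gt0 : 0 < r)
    (sigma_s_gt0 : 0 < sigma_s) (hB_range : 0 <= hB < r)
    (alpha_neq0 : alpha != 0)
    (p_range : forall k, 0 <= p k <= 1) (p_sum : \sum_k p k = 1)
    (sigma_gt0 : forall k, 0 < sigma k)
    (mean_range : forall k, - (pi / 2) <= mean k < pi / 2)
    (W_psd : psdmx W) :
  let a := steering Nt d lam (cos_elevation r hB) in
  let b := steering Nr d lam (cos_elevation r hB) in
  let pTheta := gauss_mixture p mean sigma in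
  let J := prior_fisher p mean sigma in
  let A1 := matA1 a b pTheta in
  let A2 := matA2 Nr a pTheta in
  let A3 := matA3 Nr a pTheta in
  let A4 := matA4 Nr a pTheta in
  pcrb J alpha L sigma_s A1 A2 A3 A4 W <= pcrb_upper J alpha L sigma_s A1 W.
Proof.
pose a := steering Nt d lam (cos_elevation r hB).
pose b := steering Nr d lam (cos_elevation r hB).
pose pTheta := gauss_mixture p mean sigma.
pose J := prior_fisher p mean sigma.
pose A1 := matA1 a b pTheta; pose A2 := matA2 Nr a pTheta.
pose A3 := matA3 Nr a pTheta; pose A4 := matA4 Nr a pTheta.
(* The let-bindings of the statement lie inside the boolean. *)
change (is_true (pcrb J alpha L sigma_s A1 A2 A3 A4 W
  <= pcrb_upper J alpha L sigma_s A1 W)).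
have p_ge0 k : 0 <= p k by have /andP[] := p_range k.
have J_gt0 : 0 < J by exact: prior_fisher_gt0.
have pTheta_int : rintegrable pTheta by exact: rintegrable_gauss_mixture.
have pTheta_ge0 t : 0 <= pTheta t by exact: gauss_mixture_ge0.
have a_bnd i : cbounded_measurable (fun t => a t i 0).
  exact: cbounded_steering.
have da_bnd i : cbounded_measurable (fun t => mxderive a t i 0).
  exact: cbounded_mxderive_steering.
have db_bnd i : cbounded_measurable (fun t => mxderive b t i 0).
  exact: cbounded_mxderive_steering.
have A1_ge0 : 0 <= \tr (A1 *m W) by exact: tr_matA1_ge0.
have CS : `|\tr (A3 *m W)| ^+ 2 / \tr (A4 *m W) <= \tr (A2 *m W).
  exact: tr_matA3_Cauchy_Schwarz.
have J_gt0' : 0 < J%:C by rewrite ltcR.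
have c_ge0 : 0 <= 2 * `|alpha| ^+ 2 * L%:R / (sigma_s ^+ 2)%:C.
  by rewrite divr_ge0 ?mulr_ge0 ?exprn_ge0// ler0c exprn_ge0// ltW.
(* Splitting the trace of [A1 + A2] gives the first denominator the shape
   [J + c * (t1 + t2 - q)]. *)
rewrite /pcrb /pcrb_upper mulmxDl mxtraceD.
exact: (inv_information_le J_gt0' c_ge0 A1_ge0 CS).
Qed.
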